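(* Let $n\ge 1$. Every local $\frac12$-derivation and every $2$-local $\frac12$-derivation of the Schrödinger algebra $\mathcal{S}_n$ is a $\frac12$-derivation.
   Context: All algebras are over $\mathbb{C}$. A linear map $D:\mathfrak{L}\to\mathfrak{L}$ on a Lie algebra is a $\frac12$-derivation if $D[x,y]=\frac12\big([D(x),y]+[x,D(y)]\big)$ for all $x,y\in\mathfrak{L}$. A linear map $\Delta:\mathfrak{L}\to\mathfrak{L}$ is a local $\frac12$-derivation if for every $x\in\mathfrak{L}$ there is a $\frac12$-derivation $D_x$ (depending on $x$) with $\Delta(x)=D_x(x)$. A map $\nabla:\mathfrak{L}\to\mathfrak{L}$ (not necessarily linear) is a $2$-local $\frac12$-derivation if for all $x,y\in\mathfrak{L}$ there is a $\frac12$-derivation $D_{x,y}$ with $\nabla(x)=D_{x,y}(x)$ and $\nabla(y)=D_{x,y}(y)$. The Schrödinger algebra in $(n+1)$-dimensional space-time, $\mathcal{S}_n=(\mathfrak{sl}_2\oplus\mathfrak{so}_n)\ltimes\mathfrak{h}_n$, is the complex Lie algebra with basis $\{e,f,h,z,x_i,y_i,s_{jk}\mid 1\le i\le n,\ 1\le j<k\le n\}$ (with the convention $s_{kj}=-s_{jk}$, in particular $s_{jj}=0$; for $n=1$ there are no $s_{jk}$) and the following non-trivial brackets: $[e,f]=h$, $[h,e]=2e$, $[f,h]=2f$, $[x_i,y_i]=z$, $[h,x_i]=x_i$, $[h,y_i]=-y_i$, $[e,y_i]=x_i$, $[f,x_i]=y_i$, $[s_{jk},x_i]=\delta_{ki}x_j-\delta_{ji}x_k$,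 $[s_{jk},y_i]=\delta_{ki}y_j-\delta_{ji}y_k$, $[s_{jk},s_{lm}]=\delta_{lk}s_{jm}+\delta_{jm}s_{kl}+\delta_{mk}s_{lj}+\delta_{lj}s_{mk}$, where $\delta$ is the Kronecker delta; brackets of basis elements not obtained from these by antisymmetry are zero. *)

(* Defs.v *)
From HB Require Import structures.
From mathcomp Require Import all_boot all_order all_algebra.
From mathcomp Require Import complex reals.
From mathcomp Require Import ring.
Set Implicit Arguments.
Unset Strict Implicit.
Unset Printing Implicit Defensive.
Import Order.TTheory GRing.Theory Num.Theory.
Local Open Scope ring_scope.

HB.mixin Record Lmodule_isLieAlgebra (K : fieldType) L of GRing.Lmodule K L := {
  lie : L -> L -> L;
  lie_linearl : forall y, linear (fun x => lie x y);
  lie_linearr : forall x, linear (lie x);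
  lie_alternating : forall x, lie x x = 0;
  lie_jacobi : forall x y z,
    lie x (lie y z) + lie y (lie z x) + lie z (lie x y) = 0
}.

#[short(type="lieAlgType")]
HB.structure Definition LieAlgebra (K : fieldType) :=
  {L of Lmodule_isLieAlgebra K L & GRing.Lmodule K L}.

Definition half_derivation (K : fieldType) (L : lieAlgType K) (D : L -> L) :
    Prop :=
  linear D /\
  forall x y, D (lie x y) = 2%:R^-1 *: (lie (D x) y + lie x (D y)).

Definition local_half_derivation (K : fieldType) (L : lieAlgType K)
    (Delta : L -> L) : Prop :=
  linear Delta /\
  forall x, exists2 D : L -> L, half_derivation D & Delta x = D x.

Definition two_local_half_derivation (K : fieldType) (L : lieAlgType K)
    (nabla : L -> L) : Prop :=
  forall x y, exists2 D : L -> L,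
    half_derivation D & nabla x = D x /\ nabla y = D y.

Inductive sch_basis (n : nat) : Type :=
  | Be | Bf | Bh | Bz
  | Bx of 'I_n
  | By of 'I_n
  | Bs of {jk : 'I_n * 'I_n | (jk.1 < jk.2)%N}.
Arguments Be {n}.
Arguments Bf {n}.
Arguments Bh {n}.
Arguments Bz {n}.

Definition sch_code (n : nat) (b : sch_basis n) :
    'I_4 + ('I_n + 'I_n + {jk : 'I_n * 'I_n | (jk.1 < jk.2)%N}) :=
  match b with
  | Be => inl (inord 0)
  | Bf => inl (inord 1)
  | Bh => inl (inord 2)
  | Bz => inl (inord 3)
  | Bx i => inr (inl (inl i))
  | By i => inr (inl (inr i))
  | Bs p => inr (inr p)
  end.

Definition sch_decode (n : nat)
    (c : 'I_4 + ('I_n + 'I_n + {jk : 'I_n * 'I_n | (jk.1 < jk.2)%N})) :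
    sch_basis n :=
  match c with
  | inl k => nth Bz [:: Be; Bf; Bh] k
  | inr (inl (inl i)) => Bx i
  | inr (inl (inr i)) => By i
  | inr (inr p) => Bs p
  end.

Lemma sch_codeK (n : nat) : cancel (@sch_code n) (@sch_decode n).
Proof. by case=> [||||i|i|p] //=; rewrite inordK. Qed.

HB.instance Definition _ (n : nat) :=
  Countable.copy (sch_basis n) (can_type (@sch_codeK n)).
HB.instance Definition _ (n : nat) :=
  isFinite.Build (sch_basis n) (pcan_enumP (can_pcan (@sch_codeK n))).

Definition schrodinger (K : numFieldType) (n : nat) : Type :=
  {ffun sch_basis n -> K^o}.

HB.instance Definition _ (K : numFieldType) (n : nat) :=
  GRing.Lmodule.copy (schrodinger K n) {ffun sch_basis n -> K^o}.

Definition bvec (K : numFieldType) (n : nat) (b : sch_basis n) :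
    schrodinger K n :=
  [ffun c => (c == b)%:R].

(* s_jk for arbitrary j, k, with the convention s_kj = - s_jk. *)
Definition svec (K : numFieldType) (n : nat) (j k : 'I_n) :
    schrodinger K n :=
  if insub (j, k) is Some p then bvec K (Bs p)
  else if insub (k, j) is Some p then - bvec K (Bs p)
  else 0.

Definition basis_lie (K : numFieldType) (n : nat) (a b : sch_basis n) :
    schrodinger K n :=
  let v := @bvec K n in
  let s := @svec K n in
  let d (i j : 'I_n) : K := (i == j)%:R in
  match a, b with
  | Be, Bf => v Bh
  | Bf, Be => - v Bh
  | Bh, Be => 2%:R *: v Be
  | Be, Bh => - (2%:R *: v Be)
  | Bf, Bh => 2%:R *: v Bf
  | Bh, Bf => - (2%:R *: v Bf)
  | Bx i, By j => d i j *: v Bz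
  | By j, Bx i => - (d i j *: v Bz)
  | Bh, Bx i => v (Bx i)
  | Bx i, Bh => - v (Bx i)
  | Bh, By i => - v (By i)
  | By i, Bh => v (By i)
  | Be, By i => v (Bx i)
  | By i, Be => - v (Bx i)
  | Bf, Bx i => v (By i)
  | Bx i, Bf => - v (By i)
  | Bs p, Bx i =>
      let: (j, k) := val p in d k i *: v (Bx j) - d j i *: v (Bx k)
  | Bx i, Bs p =>
      let: (j, k) := val p in - (d k i *: v (Bx j) - d j i *: v (Bx k))
  | Bs p, By i =>
      let: (j, k) := val p in d k i *: v (By j) - d j i *: v (By k)
  | By i, Bs p =>
      let: (j, k) := val p in - (d k i *: v (By j) - d j i *: v (By k))
  | Bs p, Bs q =>
      let: (j, k) := val p in
      let: (l, m) := val q in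
      d l k *: s j m + d j m *: s k l + d m k *: s l j + d l j *: s m k
  | _, _ => 0
  end.

Definition sch_lie (K : numFieldType) (n : nat) (u v : schrodinger K n) :
    schrodinger K n :=
  \sum_a \sum_b (u a * v b) *: basis_lie K a b.

Lemma sch_lie_linearl (K : numFieldType) (n : nat) (y : schrodinger K n) :
  linear (fun x => sch_lie x y).
Proof.
move=> c u v; rewrite /sch_lie scaler_sumr -big_split /=; apply: eq_bigr => a _.
rewrite scaler_sumr -big_split /=; apply: eq_bigr => b _.
by rewrite !ffunE scalerA -scalerDl mulrDl mulrA.
Qed.

Lemma sch_lie_linearr (K : numFieldType) (n : nat) (x : schrodinger K n) :
  linear (sch_lie x).
Proof.
move=> c u v; rewrite /sch_lie scaler_sumr -big_split /=; apply: eq_bigr => a _.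
rewrite scaler_sumr -big_split /=; apply: eq_bigr => b _.
by rewrite !ffunE scalerA -scalerDl mulrDr mulrCA.
Qed.

Definition tvec (K : numFieldType) (n : nat) (j k : 'I_n) :
    schrodinger K n :=
  if insub (j, k) is Some p then bvec K (Bs p) else 0.

Lemma svecE (K : numFieldType) (n : nat) (j k : 'I_n) :
  svec K j k = tvec K j k - tvec K k j.
Proof.
rewrite /svec /tvec; case: insubP => [p /= jk _|_].
  by rewrite insubF ?subr0 //= ltnNge ltnW.
by case: insubP => [p _ _|_]; rewrite sub0r ?oppr0.
Qed.

Lemma svecC (K : numFieldType) (n : nat) (j k : 'I_n) :
  svec K j k = - svec K k j.
Proof. by rewrite !svecE opprB. Qed.

Lemma sch_lie_bvec (K : numFieldType) (n : nat) (a b : sch_basis n) :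
  sch_lie (bvec K a) (bvec K b) = basis_lie K a b.
Proof.
rewrite /sch_lie (bigD1 a) //= [X in _ + X]big1 ?addr0; last first.
  move=> c /negbTE ca; rewrite big1 // => d _.
  by rewrite !ffunE ca mul0r scale0r.
rewrite (bigD1 b) //= big1 ?addr0 ?ffunE ?eqxx ?mulr1 ?scale1r //.
by move=> c /negbTE cb; rewrite !ffunE cb mulr0 scale0r.
Qed.

Lemma bvec_decomp (K : numFieldType) (n : nat) (u : schrodinger K n) :
  u = \sum_a u a *: bvec K a.
Proof.
apply/ffunP => c; rewrite sum_ffunE (bigD1 c) //= big1 ?addr0.
  by rewrite !ffunE eqxx; exact/esym/mulr1.
by move=> d /negbTE dc; rewrite !ffunE eq_sym dc; exact: mulr0.
Qed.

Lemma linear_bvec0 (K : numFieldType) (n : nat) (V : lmodType K)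
    (f : schrodinger K n -> V) :
  linear f -> (forall b, f (bvec K b) = 0) -> forall u, f u = 0.
Proof.
move=> lf f0 u; rewrite (bvec_decomp u); elim/big_rec: _ => [|a v _ IH].
  by have := lf (-1) 0 0; rewrite scaler0 addr0 scaleN1r addNr.
by rewrite lf f0 IH scaler0 addr0.
Qed.

Lemma schrodinger_sep (K : numFieldType) (n : nat) (u v : schrodinger K n) :
  (forall phi : schrodinger K n -> K,
    (forall c u v, phi (c *: u + v) = c * phi u + phi v) -> phi u = phi v) ->
  u = v.
Proof.
move=> E; apply/ffunP => b; apply: (E (fun w => w b)) => c u' v'.
by rewrite !ffunE.
Qed.

Lemma svec_ind (K : numFieldType) (n : nat)
    (Q : 'I_n -> 'I_n -> schrodinger K n -> Prop) :
  (forall p, Q (val p).1 (val p).2 (bvec K (Bs p))) ->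
  (forall j k v, Q j k v -> Q k j (- v)) -> (forall j, Q j j 0) ->
  forall j k, Q j k (svec K j k).
Proof.
move=> Qp QN Q0 j k; rewrite /svec; case: insubP => [p _ Ep|].
  by have := Qp p; rewrite Ep.
rewrite -leqNgt /= => kj; case: insubP => [p _ Ep|].
  by apply: QN; have := Qp p; rewrite Ep.
rewrite -leqNgt /= => jk.
by have -> : j = k by apply/val_inj/eqP; rewrite eqn_leq jk.
Qed.

(* The Jacobi identity is checked over an abstract module V with a separating
   family of linear forms: in the concrete space of finite functions,
   unification unfolds the module operations and is very slow. *)
Module SchrodingerJacobi.
Section AbstractJacobi.
Context (K : fieldType) (V : lmodType K) (n : nat) (B : V -> V -> V).
Context (linl : forall y, linear (fun x => B x y)).
Context (linr : forall x, linear (B x)).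
Context (sep : forall u v : V,
  (forall phi : V -> K,
    (forall c u v, phi (c *: u + v) = c * phi u + phi v) -> phi u = phi v) ->
  u = v).
Context (e f h z : V) (x y : 'I_n -> V) (t : 'I_n -> 'I_n -> V).
Local Notation s j k := (t j k - t k j).
Local Notation d i j := ((i == j)%:R : K).

Section Phi.
Context (phi : V -> K).
Context (lphi : forall c u v, phi (c *: u + v) = c * phi u + phi v).
Lemma phi0 : phi 0 = 0.
Proof. by have := lphi (-1) 0 0; rewrite scaler0 addr0 mulN1r addNr. Qed.
Lemma phiD u v : phi (u + v) = phi u + phi v.
Proof. by have := lphi 1 u v; rewrite scale1r mul1r. Qed.
Lemma phiZ c u : phi (c *: u) = c * phi u.
Proof. by have := lphi c u 0; rewrite addr0 phi0 addr0. Qed.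
Lemma phiN u : phi (- u) = - phi u.
Proof. by rewrite -scaleN1r phiZ mulN1r. Qed.
End Phi.

Lemma abs_Dl u v w : B (u + v) w = B u w + B v w.
Proof. by have := linl w 1 u v; rewrite !scale1r. Qed.
Lemma abs_Dr w u v : B w (u + v) = B w u + B w v.
Proof. by have := linr w 1 u v; rewrite !scale1r. Qed.
Lemma abs_0l w : B 0 w = 0.
Proof. by apply: (addrI (B 0 w)); rewrite -abs_Dl !addr0. Qed.
Lemma abs_0r w : B w 0 = 0.
Proof. by apply: (addrI (B w 0)); rewrite -abs_Dr !addr0. Qed.
Lemma abs_Zl c u w : B (c *: u) w = c *: B u w.
Proof. by have := linl w c u 0; rewrite !addr0 abs_0l addr0. Qed.
Lemma abs_Zr c w u : B w (c *: u) = c *: B w u.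
Proof. by have := linr w c u 0; rewrite !addr0 abs_0r addr0. Qed.
Lemma abs_Nl u w : B (- u) w = - B u w.
Proof. by rewrite -!scaleN1r abs_Zl. Qed.
Lemma abs_Nr w u : B w (- u) = - B w u.
Proof. by rewrite -!scaleN1r abs_Zr. Qed.

Context (S : 'I_n -> 'I_n -> V) (SE : forall j k, S j k = s j k).
Context (ac : forall u v, B u v = - B v u).
Context (ef : B e f = h) (he : B h e = 2%:R *: e) (fh : B f h = 2%:R *: f).
Context (xy : forall i j, B (x i) (y j) = d i j *: z).
Context (hx : forall i, B h (x i) = x i) (hy : forall i, B h (y i) = - y i).
Context (ey : forall i, B e (y i) = x i) (fx : forall i, B f (x i) = y i).
Context (ee : B e e = 0) (ff : B f f = 0) (hh : B h h = 0) (zz : B z z = 0).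
Context (ez : B e z = 0) (fz : B f z = 0) (hz : B h z = 0).
Context (zx : forall i, B z (x i) = 0) (zy : forall i, B z (y i) = 0).
Context (es : forall j k, B e (S j k) = 0) (fs : forall j k, B f (S j k) = 0).
Context (hs : forall j k, B h (S j k) = 0) (zs : forall j k, B z (S j k) = 0).
Context (ex : forall i, B e (x i) = 0) (fy : forall i, B f (y i) = 0).
Context (xx : forall i j, B (x i) (x j) = 0).
Context (yy : forall i j, B (y i) (y j) = 0).
Context (sx : forall j k i, B (S j k) (x i) = d k i *: x j - d j i *: x k).
Context (sy : forall j k i, B (S j k) (y i) = d k i *: y j - d j i *: y k).
Context (ss : forall j k l m, B (S j k) (S l m) =
  d l k *: S j m + d j m *: S k l + d m k *: S l j + d l j *: S m k).

Lemma fe : B f e = - h. Proof. by rewrite ac ef. Qed.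
Lemma eh : B e h = - (2%:R *: e). Proof. by rewrite ac he. Qed.
Lemma hf : B h f = - (2%:R *: f). Proof. by rewrite ac fh. Qed.
Lemma yx i j : B (y j) (x i) = - (d i j *: z). Proof. by rewrite ac xy. Qed.
Lemma xh i : B (x i) h = - x i. Proof. by rewrite ac hx. Qed.
Lemma yh i : B (y i) h = y i. Proof. by rewrite ac hy opprK. Qed.
Lemma ye i : B (y i) e = - x i. Proof. by rewrite ac ey. Qed.
Lemma xf i : B (x i) f = - y i. Proof. by rewrite ac fx. Qed.
Lemma xe i : B (x i) e = 0. Proof. by rewrite ac ex oppr0. Qed.
Lemma yf i : B (y i) f = 0. Proof. by rewrite ac fy oppr0. Qed.
Lemma ze : B z e = 0. Proof. by rewrite ac ez oppr0. Qed.
Lemma zf : B z f = 0. Proof. by rewrite ac fz oppr0. Qed.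
Lemma zh : B z h = 0. Proof. by rewrite ac hz oppr0. Qed.
Lemma xz i : B (x i) z = 0. Proof. by rewrite ac zx oppr0. Qed.
Lemma yz i : B (y i) z = 0. Proof. by rewrite ac zy oppr0. Qed.
Lemma se j k : B (S j k) e = 0. Proof. by rewrite ac es oppr0. Qed.
Lemma sf j k : B (S j k) f = 0. Proof. by rewrite ac fs oppr0. Qed.
Lemma sh j k : B (S j k) h = 0. Proof. by rewrite ac hs oppr0. Qed.
Lemma sz j k : B (S j k) z = 0. Proof. by rewrite ac zs oppr0. Qed.
Lemma xs j k i : B (x i) (S j k) = - (d k i *: x j - d j i *: x k).
Proof. by rewrite ac sx. Qed.
Lemma ys j k i : B (y i) (S j k) = - (d k i *: y j - d j i *: y k).
Proof. by rewrite ac sy. Qed.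

Definition absE :=
  (abs_Dl, abs_Dr, abs_Nl, abs_Nr, abs_Zl, abs_Zr, abs_0l, abs_0r).
Definition tabE :=
  (ef, fe, he, eh, fh, hf, xy, yx, hx, xh, hy, yh, ey, ye, fx, xf,
  (ee, ff, hh, zz, ez, ze, fz, zf, hz, zh, zx, xz, zy, yz),
  (es, se, fs, sf, hs, sh),
  (zs, sz, ex, xe, fy, yf, xx, yy, sx, xs, sy, ys, ss)).

Definition abs_vec (b : sch_basis n) : V :=
  match b with
  | Be => e | Bf => f | Bh => h | Bz => z
  | Bx i => x i | By i => y i | Bs p => S (val p).1 (val p).2
  end.

Definition rank (b : sch_basis n) : nat :=
  match b with
  | Be => 0 | Bf => 1 | Bh => 2 | Bz => 3 | Bx _ => 4 | By _ => 5 | Bs _ => 6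
  end.

Definition jac u v w := B u (B v w) + B v (B w u) + B w (B u v).

Lemma jacC u v w : jac u v w = - jac v u w.
Proof.
rewrite /jac (ac v w) (ac w u) (ac u v) !abs_Nr.
by rewrite -!opprD (addrC (B u _)).
Qed.

Lemma jac_rot u v w : jac u v w = jac v w u.
Proof. by rewrite /jac -addrA addrC. Qed.


Lemma jac_linearl v w : linear (fun u => jac u v w).
Proof.
move=> c u u'; rewrite /jac ?absE; apply/sep => phi lphi.
by rewrite ?(phiD lphi, phiZ lphi); ring.
Qed.

Lemma jac_sorted a b c : (rank a <= rank b <= rank c)%N ->
  jac (abs_vec a) (abs_vec b) (abs_vec c) = 0.
Proof.
case: a => [||||i|i|[[i i'] Hi]]; case: b => [||||j|j|[[j j'] Hj]];
  case: c => [||||k|k|[[k k'] Hk]] //= _;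
  rewrite /jac ?(tabE, absE); apply/sep => phi lphi;
  rewrite ?SE ?(phiD lphi, phiN lphi, phiZ lphi, phi0 lphi); try ring.
all: try (rewrite ?(eq_sym i j) ?(eq_sym i k) ?(eq_sym i k') ?(eq_sym j k)
  ?(eq_sym j k') ?(eq_sym k k'); ring).
all: rewrite ?(eq_sym i j) ?(eq_sym i j') ?(eq_sym i k) ?(eq_sym i k')
  ?(eq_sym j j') ?(eq_sym j k) ?(eq_sym j k') ?(eq_sym j' k) ?(eq_sym j' k')
  ?(eq_sym k k').
all: try ring.
all: rewrite ?(eq_sym i i') ?(eq_sym i j) ?(eq_sym i j') ?(eq_sym i k)
  ?(eq_sym i k') ?(eq_sym i' j) ?(eq_sym i' j') ?(eq_sym i' k) ?(eq_sym i' k')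
  ?(eq_sym j j') ?(eq_sym j k) ?(eq_sym j k') ?(eq_sym j' k) ?(eq_sym j' k')
  ?(eq_sym k k').
all: ring.
Qed.

Lemma jac_basis a b c : jac (abs_vec a) (abs_vec b) (abs_vec c) = 0.
Proof.
have N0 u v w : jac v u w = 0 -> jac u v w = 0.
  by move=> E; rewrite jacC E oppr0.
have R0 u v w : jac v w u = 0 -> jac u v w = 0.
  by move=> E; rewrite jac_rot.
case: (leqP (rank a) (rank b)) => ab; case: (leqP (rank b) (rank c)) => bc;
  case: (leqP (rank a) (rank c)) => ac'.
- by apply: jac_sorted; rewrite ab bc.
- by apply: jac_sorted; rewrite ab bc.
- by apply/R0/N0/R0/R0/jac_sorted; rewrite ac' ltnW.
- by apply/R0/R0/jac_sorted; rewrite (ltnW ac').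
- by apply/N0/jac_sorted; rewrite (ltnW ab).
- by apply/R0/jac_sorted; rewrite bc (ltnW ac').
- by have := leq_trans ac' (ltnW bc); rewrite leqNgt ab.
- by apply/N0/R0/R0/jac_sorted; rewrite ?(ltnW bc) ?(ltnW ab).
Qed.

Context (gen : forall f : V -> V,
  linear f -> (forall b, f (abs_vec b) = 0) -> forall u, f u = 0).

Lemma abs_jacobi u v w : jac u v w = 0.
Proof.
move: u; apply: gen => [|a]; first exact: jac_linearl.
rewrite jac_rot; move: v; apply: gen => [|b]; first exact: jac_linearl.
rewrite jac_rot; move: w; apply: gen => [|c]; first exact: jac_linearl.
exact: jac_basis.
Qed.

End AbstractJacobi.
End SchrodingerJacobi.

Section SchrodingerLie.
Import SchrodingerJacobi.
Context (K : numFieldType) (n : nat).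
Local Notation V := (schrodinger K n).
Local Notation B := (@sch_lie K n).
Local Notation v := (@bvec K n).
Local Notation s := (@svec K n).
Local Notation d i j := ((i == j)%:R : K).
Let ll := @sch_lie_linearl K n.
Let lr := @sch_lie_linearr K n.

Lemma basis_lieC (a b : sch_basis n) : basis_lie K a b = - basis_lie K b a.
Proof.
case: a b => [||||i|i|p] [||||j|j|q];
  try exact: (esym (opprK _)); try exact: (esym (@oppr0 V)); try exact: erefl.
- by rewrite /basis_lie; case: (val q) => l m; exact: erefl.
- by rewrite /basis_lie; case: (val q) => l m; exact: erefl.
- by rewrite /basis_lie; case: (val p) => l m; exact: (esym (opprK _)).
- by rewrite /basis_lie; case: (val p) => l m; exact: (esym (opprK _)).
rewrite /basis_lie; case: (val p) => j k; case: (val q) => l m.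
apply: schrodinger_sep => phi lphi; rewrite !svecE.
rewrite ?(phiD lphi, phiN lphi, phiZ lphi, phi0 lphi).
by rewrite (eq_sym l k) (eq_sym j m) (eq_sym k m) (eq_sym l j); ring.
Qed.

Lemma sch_lieC (x y : V) : B x y = - B y x.
Proof.
apply/eqP; rewrite -subr_eq0 opprK; apply/eqP; move: x.
apply: linear_bvec0 => [c u w|a].
  by rewrite (abs_Dl ll) (abs_Dr lr) (abs_Zl ll) (abs_Zr lr) scalerDr addrACA.
move: y; apply: linear_bvec0 => [c u w|b].
  by rewrite (abs_Dl ll) (abs_Dr lr) (abs_Zl ll) (abs_Zr lr) scalerDr addrACA.
by rewrite !sch_lie_bvec basis_lieC addNr.
Qed.

Lemma sch_liexx (x : V) : B x x = 0.
Proof.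
have /eqP := sch_lieC x x; rewrite -addr_eq0 -mulr2n -scaler_nat scaler_eq0.
by rewrite pnatr_eq0 /= => /eqP.
Qed.

Lemma sch_lie_sl (w : V) (F : 'I_n -> 'I_n -> V) :
  (forall p, B (v (Bs p)) w = F (val p).1 (val p).2) ->
  (forall j k, F k j = - F j k) -> forall j k, B (s j k) w = F j k.
Proof.
move=> Fp FN; apply: (@svec_ind K n (fun j k u => B u w = F j k)) => //.
  by move=> j k u E; rewrite (abs_Nl ll) E -FN.
move=> j; rewrite (abs_0l ll); apply/esym/eqP.
have /eqP := FN j j; rewrite -addr_eq0 -mulr2n -scaler_nat scaler_eq0.
by rewrite pnatr_eq0.
Qed.

Lemma sch_lie_s0 (w : V) : (forall p, B (v (Bs p)) w = 0) ->
  forall j k, B w (s j k) = 0.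
Proof.
move=> Fp j k; rewrite sch_lieC (sch_lie_sl (F := fun _ _ => 0)) ?oppr0 //.
Qed.

Lemma sch_lie_sx j k i :
  B (s j k) (v (Bx i)) = d k i *: v (Bx j) - d j i *: v (Bx k).
Proof.
move: j k; apply: sch_lie_sl.
  by case=> -[j k] jk; rewrite sch_lie_bvec.
by move=> j k; rewrite opprD opprK addrC.
Qed.

Lemma sch_lie_sy j k i :
  B (s j k) (v (By i)) = d k i *: v (By j) - d j i *: v (By k).
Proof.
move: j k; apply: sch_lie_sl.
  by case=> -[j k] jk; rewrite sch_lie_bvec.
by move=> j k; rewrite opprD opprK addrC.
Qed.

Lemma sch_lie_ss j k l m :
  B (s j k) (s l m) =
  d l k *: s j m + d j m *: s k l + d m k *: s l j + d l j *: s m k.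
Proof.
pose F j k l m : V :=
  d l k *: s j m + d j m *: s k l + d m k *: s l j + d l j *: s m k.
rewrite -[RHS]/(F j k l m).
have FN j' k' l' m' : F k' j' l' m' = - F j' k' l' m'.
  apply: schrodinger_sep => phi lphi; rewrite /F !svecE.
  rewrite ?(phiD lphi, phiN lphi, phiZ lphi, phi0 lphi).
  by rewrite (eq_sym m' k') (eq_sym m' j'); ring.
have FC j' k' l' m' : F j' k' l' m' = - F l' m' j' k'.
  apply: schrodinger_sep => phi lphi; rewrite /F !svecE.
  rewrite ?(phiD lphi, phiN lphi, phiZ lphi, phi0 lphi).
  by rewrite (eq_sym m' k') (eq_sym l' j'); ring.
move: j k; apply: sch_lie_sl => [p|j k]; last exact: FN.
rewrite sch_lieC FC; congr (- _).
move: l m; apply: sch_lie_sl => [q|j k]; last exact: FN.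
rewrite sch_lie_bvec /basis_lie /F.
by case: (val p) => ? ?; case: (val q).
Qed.

Lemma sch_lie_jacobi (x y z : V) : B x (B y z) + B y (B z x) + B z (B x y) = 0.
Proof.
apply: (@abs_jacobi K V n B ll lr (@schrodinger_sep K n)
  (v Be) (v Bf) (v Bh) (v Bz) (fun i => v (Bx i)) (fun i => v (By i))
  (@tvec K n) s (@svecE K n) sch_lieC);
  try by move=> *; rewrite sch_lie_bvec.
all: try by apply: sch_lie_s0 => p; rewrite sch_lie_bvec.
- by move=> *; exact: sch_lie_sx.
- by move=> *; exact: sch_lie_sy.
- by move=> *; exact: sch_lie_ss.
move=> f lf f0; apply: linear_bvec0 => // b; have := f0 b.
case: b => //= p; rewrite /svec -surjective_pairing valK; exact.
Qed.

End SchrodingerLie.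

HB.instance Definition _ (K : numFieldType) (n : nat) :=
  Lmodule_isLieAlgebra.Build K (schrodinger K n)
    (@sch_lie_linearl K n) (@sch_lie_linearr K n)
    (@sch_liexx K n) (@sch_lie_jacobi K n).

(* Main.v *)
From HB Require Import structures.
Require Import Defs.
From mathcomp Require Import all_boot all_order all_algebra.
From mathcomp Require Import complex reals.
From mathcomp Require Import ring.
Import GRing.Theory Num.Theory.
Local Open Scope ring_scope.
Set Implicit Arguments.
Unset Strict Implicit.
Unset Printing Implicit Defensive.

(** Everything follows from a description of all half-derivations of the
Schroedinger algebra (half_derivationP): they are the maps
  D u = a u + phi(u) z,
with a a scalar and phi a linear form that vanishes on all brackets.

Such maps are half-derivations because z is central.  Conversely, let D be a
half-derivation.  Comparing coordinates in the three defining relations of sl_2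
shows that D acts on e, f, h as one scalar a (half_derivation_sl2), so that
D' = D - a kills sl_2.  For a half-derivation D' and an element g that it
kills, D'[g,u] = [g,D'u]/2.  If D' kills g and g', it kills [g,g'], and then
D'[[g,g'],u] is both [[g,g'],D'u]/2 and, by the Jacobi identity, [[g,g'],D'u]/4,
so [[g,g'],D'u] = 0.  As sl_2 is perfect, the values of D' are sl_2-invariant,
and D' vanishes on [sl_2,L].  It follows that D' kills the brackets [x_i,u], so
its values commute with the x_i as well.  What commutes with sl_2 and with all
x_i is a multiple of z (half_derivation_central), and D' kills brackets because
its values are central.

The form phi is in fact determined by one number: all basis vectors except one
are brackets (bvec_lie).  If n = 2, the exception is s_12, which is the only
rotation.  If n > 2 every s_jk is a bracket [s_jl,s_lk], and for n < 2 there is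
no s_jk at all.  So a half-derivation is determined by its value at a single
basis vector b0, and a 2-local half-derivation nabla coincides with the
half-derivation attached to the pair (b0,b0): at u, compare with the one
attached to (b0,u).

For a local half-derivation Delta, every u is an eigenvector of Delta modulo z.
Comparing u = b and u = e + b shows that all basis vectors b have the same
eigenvalue a.  Linearity gives Delta u = a u + psi(u) z with psi linear, and psi
kills brackets because Delta maps a bracket to a multiple of itself. *)

(** * Half-derivations of Lie algebras *)

Section LieAlgebra.
Context (K : numFieldType) (L : lieAlgType K).
Implicit Types (x y u v : L) (c : K) (D : L -> L).

HB.instance Definition _ x :=
  GRing.isLinear.Build K L L *:%R (lie x) (lie_linearr x).

Lemma lieC x y : lie x y = - lie y x.
Proof.
have lDl u v w : lie (u + v) w = lie u w + lie v w.
  by have := lie_linearl w 1 u v; rewrite !scale1r.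
have := lie_alternating (x + y).
rewrite lDl !raddfD /= !lie_alternating add0r addr0 => /eqP.
by rewrite addr_eq0 => /eqP.
Qed.

Lemma lieDl x u v : lie (u + v) x = lie u x + lie v x.
Proof. by rewrite ![lie _ x]lieC raddfD opprD. Qed.

Lemma lieZl x c u : lie (c *: u) x = c *: lie u x.
Proof. by rewrite ![lie _ x]lieC linearZ scalerN. Qed.

Lemma lieNl x u : lie (- u) x = - lie u x.
Proof. by rewrite ![lie _ x]lieC raddfN. Qed.

Lemma lie0l x : lie 0 x = 0.
Proof. by rewrite lieC raddf0 oppr0. Qed.

Lemma lieDr x u v : lie x (u + v) = lie x u + lie x v.
Proof. exact: raddfD. Qed.

Lemma lieZr x c u : lie x (c *: u) = c *: lie x u.
Proof. exact: linearZ. Qed.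

Lemma lieA x y u : lie (lie x y) u = lie x (lie y u) - lie y (lie x u).
Proof.
have := lie_jacobi x y u; rewrite [lie u (lie x y)]lieC [lie u x]lieC raddfN /=.
by move/eqP; rewrite subr_eq0 => /eqP.
Qed.

Lemma eq_half_derivation D D' :
  D =1 D' -> half_derivation D -> half_derivation D'.
Proof.
move=> DE [lD dD]; split=> [c u v|x y]; first by rewrite -!DE lD.
by rewrite -!DE dD.
Qed.

Lemma half_derivation_subZ D a :
  half_derivation D -> half_derivation (fun u => D u - a *: u).
Proof.
move=> [lD dD]; split=> [c u v|x y].
  by rewrite lD scalerDr scalerA mulrC -scalerA opprD addrACA -scalerBr.
rewrite dD; apply: (@scalerI _ _ 2%:R); first by rewrite pnatr_eq0.
rewrite scalerBr !scalerA !divff ?pnatr_eq0 // !scale1r.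
rewrite lieDl lieNl lieZl linearB linearZ /= addrACA -opprD linearZ /=.
by rewrite -scalerDl scalerN mulr_natl mulr2n.
Qed.

Lemma half_derivation_scaled D c x y w : half_derivation D ->
  lie x y = c *: w -> (2%:R * c) *: D w = lie x (D y) - lie y (D x).
Proof.
move=> [lD dD] xy; rewrite -scalerA -(GRing.scalable_linear lD) -xy dD.
by rewrite scalerA divff ?pnatr_eq0 // scale1r addrC [lie (D x) y]lieC.
Qed.

Section KillsSl2.
Context (D : L -> L) (hD : half_derivation D) (e f h : L).
Context (ef : lie e f = h).
Context (he : lie h e = 2%:R *: e) (fh : lie f h = 2%:R *: f).
Context (De : D e = 0) (Df : D f = 0) (Dh : D h = 0).

HB.instance Definition _ := GRing.isLinear.Build K L L *:%R D hD.1.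

Lemma half_derivation_ker g u : D g = 0 -> 2%:R *: D (lie g u) = lie g (D u).
Proof.
move=> Dg; rewrite hD.2 Dg lie0l add0r scalerA divff ?pnatr_eq0 //.
by rewrite scale1r.
Qed.

(** Expanding D[[g,g'],u] as a half-derivation at [g,g'] gives [[g,g'],Du]/2,
while expanding [g,[g',u]] - [g',[g,u]] gives two factors 1/2, that is
[[g,g'],Du]/4. *)
Lemma half_derivation_commutator g g' u : D g = 0 -> D g' = 0 ->
  lie (lie g g') (D u) = 0.
Proof.
move=> Dg Dg'.
have Dgg : D (lie g g') = 0 by rewrite hD.2 Dg Dg' lie0l raddf0 addr0 scaler0.
have ker2 a b : D a = 0 -> D b = 0 ->
    2%:R *: (2%:R *: D (lie a (lie b u))) = lie a (lie b (D u)).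
  move=> Da Db; rewrite (half_derivation_ker _ Da).
  by rewrite -(half_derivation_ker u Db) linearZ.
have : 2%:R *: lie (lie g g') (D u) = lie (lie g g') (D u).
  rewrite -{1}(half_derivation_ker u Dgg) lieA raddfB /= !scalerBr.
  by rewrite (ker2 g g') ?(ker2 g' g) // -lieA.
by rewrite scaler_nat mulr2n => /eqP; rewrite -subr_eq0 addrK => /eqP.
Qed.

Lemma half_derivation_invariant u :
  [/\ lie e (D u) = 0, lie f (D u) = 0 & lie h (D u) = 0].
Proof.
have n2 : 2%:R != 0 :> K by rewrite pnatr_eq0.
split; last by rewrite -ef half_derivation_commutator.
  apply: (scalerI n2).
  by rewrite -lieZl -he half_derivation_commutator ?scaler0.
apply: (scalerI n2).
by rewrite -lieZl -fh half_derivation_commutator ?scaler0.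
Qed.

Lemma half_derivation_kills u :
  [/\ D (lie e u) = 0, D (lie f u) = 0 & D (lie h u) = 0].
Proof.
have n2 : 2%:R != 0 :> K by rewrite pnatr_eq0.
have [Ee Ef Eh] := half_derivation_invariant u.
by split; apply: (scalerI n2); rewrite half_derivation_ker // scaler0.
Qed.

(** Writing w = [h,w], the Jacobi identity gives
D[w,u] = D[h,[w,u]] - D[w,[h,u]]; the first term is in D[h,L] = 0, the second
is half of [w,D[h,u]], which is 0 for the same reason. *)
Lemma half_derivation_kills_lie w u : lie h w = w -> D (lie w u) = 0.
Proof.
have n2 : 2%:R != 0 :> K by rewrite pnatr_eq0.
move=> hw.
have Dw : D w = 0 by have [_ _] := half_derivation_kills w; rewrite hw.
rewrite -{1}hw lieA raddfB /=; have [_ _ ->] := half_derivation_kills (lie w u).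
rewrite sub0r; apply/eqP; rewrite oppr_eq0; apply/eqP.
apply: (scalerI n2); rewrite half_derivation_ker // scaler0.
by have [_ _ ->] := half_derivation_kills u; rewrite raddf0.
Qed.
End KillsSl2.
End LieAlgebra.

(** * Coordinates of the bracket of the Schroedinger algebra *)

Section Schrodinger.
Context (K : numFieldType) (n : nat).
Local Notation V := (schrodinger K n).
Local Notation v := (@bvec K n).
Implicit Types (u w : V) (b c : sch_basis n).

Lemma bvecE b c : v b c = (c == b)%:R.
Proof. by rewrite ffunE. Qed.

Lemma lie_bvec a b : lie (v a) (v b) = basis_lie K a b.
Proof. exact: sch_lie_bvec. Qed.

Lemma linear_bvec_eq (W : lmodType K) (F G : V -> W) : linear F -> linear G ->
  (forall b, F (v b) = G (v b)) -> F =1 G.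
Proof.
move=> lF lG FG u; apply/eqP; rewrite -subr_eq0; apply/eqP; move: u.
apply: linear_bvec0 => [a u w|b]; last by rewrite FG subrr.
by rewrite lF lG opprD addrACA scalerBr.
Qed.

(** The equality test comes from an encoding of the basis and does not reduce
well; this is its expected computation rule. *)
Lemma sch_eqE b c : (b == c) = match b, c with
  | Be, Be | Bf, Bf | Bh, Bh | Bz, Bz => true
  | Bx i, Bx j => i == j | By i, By j => i == j | Bs p, Bs q => p == q
  | _, _ => false end.
Proof.
case: b c => [||||i|i|p] [||||j|j|q];
  try (by apply/eqP); by apply/eqP/eqP => [[]|->].
Qed.

Lemma lie_e_coord u c : lie (v Be) u c = match c with
  | Be => - (2%:R * u Bh) | Bh => u Bf | Bx i => u (By i) | _ => 0 end.
Proof.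
move: u; apply: (@linear_bvec_eq K^o).
- by move=> a u w; rewrite lie_linearr !ffunE.
- by move=> a u w; case: c => [||||i|i|p]; rewrite ?ffunE /GRing.scale /=; ring.
move=> b; rewrite lie_bvec.
by case: b => [||||j|j|q]; case: c => [||||i|i|p] /=;
  rewrite ?ffunE /GRing.scale /= ?sch_eqE ?mulr0 ?oppr0.
Qed.

Lemma lie_f_coord u c : lie (v Bf) u c = match c with
  | Bf => 2%:R * u Bh | Bh => - u Be | By i => u (Bx i) | _ => 0 end.
Proof.
move: u; apply: (@linear_bvec_eq K^o).
- by move=> a u w; rewrite lie_linearr !ffunE.
- by move=> a u w; case: c => [||||i|i|p]; rewrite ?ffunE /GRing.scale /=; ring.
move=> b; rewrite lie_bvec.
by case: b => [||||j|j|q]; case: c => [||||i|i|p] /=;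
  rewrite ?ffunE /GRing.scale /= ?sch_eqE ?mulr0 ?oppr0.
Qed.

Lemma lie_h_coord u c : lie (v Bh) u c = match c with
  | Be => 2%:R * u Be | Bf => - (2%:R * u Bf) | Bx i => u (Bx i)
  | By i => - u (By i) | _ => 0 end.
Proof.
move: u; apply: (@linear_bvec_eq K^o).
- by move=> a u w; rewrite lie_linearr !ffunE.
- by move=> a u w; case: c => [||||i|i|p]; rewrite ?ffunE /GRing.scale /=; ring.
move=> b; rewrite lie_bvec.
by case: b => [||||j|j|q]; case: c => [||||i|i|p] /=;
  rewrite ?ffunE /GRing.scale /= ?sch_eqE ?mulr0 ?oppr0.
Qed.

(** Bracketing with x_k reads off the rotation coordinates: the only basis
vector whose bracket with x_k involves x_j, for j < k, is s_jk. *)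
Lemma lie_x_coord u (p : {jk : 'I_n * 'I_n | (jk.1 < jk.2)%N}) :
  lie (v (Bx (val p).2)) u (Bx (val p).1) = - u (Bs p).
Proof.
have p12 : ((val p).1 == (val p).2) = false.
  by apply/eqP => E; have := valP p; rewrite E ltnn.
move: u; apply: (@linear_bvec_eq K^o).
- by move=> a u w; rewrite lie_linearr !ffunE.
- by move=> a u w; rewrite ?ffunE /GRing.scale /=; ring.
move=> b; rewrite lie_bvec.
case: b => [||||j|j|q]; last first.
all: try by rewrite /= !ffunE /GRing.scale /= ?sch_eqE /= ?p12 ?mulr0 ?oppr0.
rewrite bvecE sch_eqE -(inj_eq val_inj) /basis_lie.
have := valP q; have := valP p.
case: (val p) p12 (val q) => [j k] /= jk' [l m] /= jk lm.
rewrite !ffunE /GRing.scale /= !sch_eqE xpair_eqE.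
case: (eqVneq l k) => [lk|_]; last first.
  by rewrite mul0r subr0 (eq_sym m) -natrM mulnb andbC.
rewrite -lk in jk *.
have -> : (j == m) = false.
  by apply/eqP => E; have := ltn_trans jk lm; rewrite E ltnn.
have -> : (j == l) = false by apply/eqP => E; move: jk; rewrite E ltnn.
by rewrite !mulr0 subr0.
Qed.

Lemma lie_z u : lie (v Bz) u = 0.
Proof.
move: u; apply: linear_bvec0; first exact: lie_linearr.
by case=> *; rewrite lie_bvec.
Qed.

Lemma sl2_invariant_coord u c :
  lie (v Be) u = 0 -> lie (v Bf) u = 0 -> lie (v Bh) u = 0 ->
  match c with Bz | Bs _ => True | _ => u c = 0 end.
Proof.
have n2 : 2%:R != 0 :> K by rewrite pnatr_eq0.
move=> ue uf uh; case: c => [||||i|i|p] //.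
- have := lie_f_coord u Bh; rewrite uf ffunE => /esym/eqP.
  by rewrite oppr_eq0 => /eqP.
- by have := lie_e_coord u Bh; rewrite ue ffunE.
- have := lie_f_coord u Bf; rewrite uf ffunE => /esym/eqP.
  by rewrite mulf_eq0 (negPf n2) => /eqP.
- by have := lie_f_coord u (By i); rewrite uf ffunE.
- by have := lie_e_coord u (Bx i); rewrite ue ffunE.
Qed.

(** * The half-derivations of the Schroedinger algebra *)

(** The relations of sl_2 give, for the adjoint operators E, F, H,
4 De = H De - E Dh, 4 Df = F Dh - H Df and 2 Dh = E Df - F De.  In each
coordinate this is a small linear system, whose solutions are the multiples of
the identity. *)
Lemma half_derivation_sl2 (D : V -> V) : half_derivation D ->
  exists a,
    [/\ D (v Be) = a *: v Be, D (v Bf) = a *: v Bf & D (v Bh) = a *: v Bh].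
Proof.
move=> hD.
have ad_eq a (b1 b2 b3 : sch_basis n) : basis_lie K b1 b2 = a *: v b3 ->
    forall c, 2%:R * a * D (v b3) c
      = lie (v b1) (D (v b2)) c - lie (v b2) (D (v b1)) c.
  rewrite -lie_bvec => /(half_derivation_scaled hD)/ffunP E c.
  by have := E c; rewrite !ffunE.
have E1 := ad_eq 2%:R Bh Be Be erefl.
have E2 := ad_eq 2%:R Bf Bh Bf erefl.
have E3 := ad_eq 1 Be Bf Bh (esym (scale1r _)).
(* Each coordinate follows from a combination of the equations that reads
   k t = 0 for a positive integer k. *)
have Z k (t A B : K) : A = B -> k.+1%:R * t = A - B -> t = 0.
  move=> ->; rewrite subrr => /eqP.
  by rewrite mulf_eq0 pnatr_eq0 /= => /eqP.
have Ee c : D (v Be) c = D (v Bh) Bh * (c == Be)%:R.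
  apply/eqP; rewrite -subr_eq0; apply/eqP; have := E1 c.
  rewrite lie_h_coord lie_e_coord.
  case: c => [||||i|i|p] H; rewrite sch_eqE /= ?mulr0 ?mulr1 ?subr0.
  - by apply: (Z 1 _ _ _ H); ring.
  - by apply: (Z 5 _ _ _ H); ring.
  - have H2 := E3 Bf; rewrite lie_f_coord lie_e_coord in H2.
    have /= H3 := congr2 (fun s t : K => 2%:R * s - t) H H2.
    by apply: (Z 5 _ _ _ H3); ring.
  - by apply: (Z 3 _ _ _ H); ring.
  - have H2 := E3 (By i); rewrite lie_f_coord lie_e_coord in H2.
    have /= H3 := congr2 (fun s t : K => 2%:R * s - t) H H2.
    by apply: (Z 4 _ _ _ H3); ring.
  - by apply: (Z 4 _ _ _ H); ring.
  - by apply: (Z 3 _ _ _ H); ring.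
have Ef c : D (v Bf) c = D (v Bh) Bh * (c == Bf)%:R.
  apply/eqP; rewrite -subr_eq0; apply/eqP; have := E2 c.
  rewrite lie_h_coord lie_f_coord.
  case: c => [||||i|i|p] H; rewrite sch_eqE /= ?mulr0 ?mulr1 ?subr0.
  - by apply: (Z 5 _ _ _ H); ring.
  - by apply: (Z 1 _ _ _ H); ring.
  - have H2 := E3 Be; rewrite lie_f_coord lie_e_coord in H2.
    have /= H3 := congr2 (fun s t : K => 2%:R * s - t) H H2.
    by apply: (Z 5 _ _ _ H3); ring.
  - by apply: (Z 3 _ _ _ H); ring.
  - by apply: (Z 4 _ _ _ H); ring.
  - have H2 := E3 (Bx i); rewrite lie_f_coord lie_e_coord in H2.
    have /= H3 := congr2 (fun s t : K => 2%:R * s + t) H H2.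
    by apply: (Z 4 _ _ _ H3); ring.
  - by apply: (Z 3 _ _ _ H); ring.
exists (D (v Bh) Bh); split; apply/ffunP => c; rewrite [RHS]ffunE bvecE.
- exact: Ee.
- exact: Ef.
have := E3 c; rewrite lie_e_coord lie_f_coord => H.
apply/eqP; rewrite -subr_eq0; apply/eqP; rewrite /GRing.scale /=.
case: c H => [||||i|i|p]; rewrite ?Ee ?Ef !sch_eqE /= => H;
  apply: (Z 1%N _ _ _ H); ring.
Qed.

(** The sl_2-invariants are spanned by z and the s_jk; commuting with the x_i
excludes the s_jk. *)
Lemma half_derivation_central (D : V -> V) : half_derivation D ->
  D (v Be) = 0 -> D (v Bf) = 0 -> D (v Bh) = 0 ->
  forall u, D u = D u Bz *: v Bz.
Proof.
move=> hD De Df Dh u.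
have ef : lie (v Be) (v Bf) = v Bh by rewrite lie_bvec.
have he : lie (v Bh) (v Be) = 2%:R *: v Be by rewrite lie_bvec.
have fh : lie (v Bf) (v Bh) = 2%:R *: v Bf by rewrite lie_bvec.
have hx i : lie (v Bh) (v (Bx i)) = v (Bx i) by rewrite lie_bvec.
have [ue uf uh] := half_derivation_invariant hD ef he fh De Df Dh u.
have Dx i : D (v (Bx i)) = 0.
  have [_ _] := half_derivation_kills hD ef he fh De Df Dh (v (Bx i)).
  by rewrite hx.
have Dxu i : lie (v (Bx i)) (D u) = 0.
  rewrite -(half_derivation_ker hD) //.
  rewrite (half_derivation_kills_lie hD ef he fh De Df Dh u (hx i)).
  by rewrite scaler0.
apply/ffunP => c; rewrite [RHS]ffunE bvecE sch_eqE.
have := sl2_invariant_coord c ue uf uh.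
case: c => [||||i|i|p] /=; rewrite /GRing.scale /= ?mulr0 ?mulr1 //.
move=> _; have := lie_x_coord (D u) p; rewrite Dxu ffunE => /esym/eqP.
by rewrite oppr_eq0 => /eqP.
Qed.

Lemma half_derivationP (D : V -> V) : half_derivation D <->
  exists a (phi : V -> K^o), [/\ linear phi, forall u w, phi (lie u w) = 0
    & forall u, D u = a *: u + phi u *: v Bz].
Proof.
split=> [hD|[a [phi [lphi phi0 DE]]]]; last first.
  split=> [c u w|u w].
    by rewrite !DE lphi !scalerDr scalerDl !scalerA addrACA (mulrC a).
  rewrite !DE phi0 scale0r addr0 lieDl !lieZl lie_z scaler0 addr0.
  rewrite lieDr !lieZr [lie u (v Bz)]lieC lie_z oppr0 scaler0 addr0.
  by rewrite -mulr2n -scaler_nat scalerA mulVf ?pnatr_eq0 ?scale1r.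
have [a [De Df Dh]] := half_derivation_sl2 hD; exists a.
pose D' u := D u - a *: u.
have hD' : half_derivation D' := half_derivation_subZ a hD.
have D'E u : D' u = D' u Bz *: v Bz.
  by apply: half_derivation_central; rewrite // /D' ?De ?Df ?Dh subrr.
exists (fun u => D' u Bz); split=> [c u w|u w|u].
- by rewrite hD'.1 !ffunE.
- rewrite hD'.2 (D'E u) (D'E w) lieZl lie_z scaler0.
  by rewrite lieC lieZl lie_z scaler0 oppr0 addr0 scaler0 ffunE.
- by rewrite -D'E addrC subrK.
Qed.

(** * Local and 2-local half-derivations *)

(** The exception b0 is some s_jk if there is one, and e otherwise.  If there
are two different rotations then n > 2, so that each s_jk has an index l
different from j and k, and s_jk = [s_jl,s_lk]. *)
Lemma bvec_lie (hn : (0 < n)%N) : exists2 b0 : sch_basis n, b0 != Bz &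
  forall b, b != b0 -> exists x y : V, v b = lie x y.
Proof.
have n2 : 2%:R != 0 :> K by rewrite pnatr_eq0.
have B b : match b with Bs _ => True | _ => exists x y : V, v b = lie x y end.
  case: b => [||||i|i|p] //.
  - exists (2%:R^-1 *: v Bh), (v Be).
    by rewrite lieZl lie_bvec scalerA mulVf ?scale1r.
  - exists (2%:R^-1 *: v Bf), (v Bh).
    by rewrite lieZl lie_bvec scalerA mulVf ?scale1r.
  - by exists (v Be), (v Bf); rewrite lie_bvec.
  - exists (v (Bx (Ordinal hn))), (v (By (Ordinal hn))).
    by rewrite lie_bvec /basis_lie eqxx scale1r.
  - by exists (v Bh), (v (Bx i)); rewrite lie_bvec.
  - by exists (v Bf), (v (Bx i)); rewrite lie_bvec.
case: (pickP {: {jk : 'I_n * 'I_n | (jk.1 < jk.2)%N}}) => [p _|nop]; last first.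
  exists Be => [|b _]; first by rewrite sch_eqE.
  by have := B b; case: b => // q; have := nop q.
exists (Bs p) => [|b]; first by rewrite sch_eqE.
case: b (B b) => // q _; rewrite sch_eqE => qp.
have [l lj lk] : exists2 l : 'I_n, l != (val q).1 & l != (val q).2.
  (* If j < k were the only indices, j' < k' would force (j', k') = (j, k). *)
  have := valP q; have := valP p; move: qp; rewrite -(inj_eq val_inj).
  case: (val p) (val q) => [j' k'] [j k] /=; rewrite xpair_eqE => qp jk' jk.
  case: (boolP [exists l, (l != j) && (l != k)]) => [/existsP[l /andP[]]|].
    by exists l.
  move=> /existsPn/= N; case/negP: qp.
  have := N j'; have := N k'; rewrite !negb_and !negbK.
  move=> /orP[]/eqP kE /orP[]/eqP jE; rewrite kE jE ?eqxx // in jk' *.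
  - by rewrite ltnn in jk'.
  - by have := ltn_trans jk jk'; rewrite ltnn.
  - by rewrite ltnn in jk'.
exists (svec K (val q).1 l), (svec K l (val q).2).
rewrite [RHS]sch_lie_ss eqxx (negPf lj) [(_ == l)]eq_sym (negPf lk).
have -> : ((val q).1 == (val q).2) = false.
  by apply/eqP => E; have := valP q; rewrite E ltnn.
rewrite !scale0r !addr0 scale1r /svec -surjective_pairing valK //.
Qed.

(** The scalar a is the b0-coordinate of D b0, as b0 is not z; the z-coordinate
of D b0 is phi(b0), and phi vanishes at the other basis vectors. *)
Lemma half_derivation_separating (hn : (0 < n)%N) : exists b0 : sch_basis n,
  forall D D' : V -> V, half_derivation D -> half_derivation D' ->
  D (v b0) = D' (v b0) -> D =1 D'.
Proof.
have [b0 b0z gen] := bvec_lie hn; exists b0 => D D'.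
move=> /half_derivationP[a [phi [lphi phi0 DE]]].
move=> /half_derivationP[a' [phi' [lphi' phi0' DE']]].
rewrite DE DE' => /ffunP E.
have aE : a = a'.
  have := E b0; rewrite !ffunE eqxx (negPf b0z) /GRing.scale /=.
  by rewrite !mulr1 !mulr0 !addr0.
have pE : phi (v b0) = phi' (v b0).
  have := E Bz; rewrite !ffunE eqxx eq_sym (negPf b0z) /GRing.scale /=.
  by rewrite !mulr1 !mulr0 !add0r.
have phiE : phi =1 phi'.
  apply: linear_bvec_eq => // b; case: (eqVneq b b0) => [->//|/gen[x [y ->]]].
  by rewrite phi0 phi0'.
by move=> u; rewrite DE DE' aE phiE.
Qed.

Lemma two_local_half_derivation_schrodinger (hn : (0 < n)%N) (nabla : V -> V) :
  two_local_half_derivation nabla -> half_derivation nabla.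
Proof.
move=> loc; have [b0 sep] := half_derivation_separating hn.
have [D hD [nD _]] := loc (v b0) (v b0).
apply: (eq_half_derivation _ hD) => u.
have [D' hD' [nD' ->]] := loc (v b0) u.
by apply: sep => //; rewrite -nD -nD'.
Qed.

Lemma local_half_derivation_schrodinger (hn : (0 < n)%N) (Delta : V -> V) :
  local_half_derivation Delta -> half_derivation Delta.
Proof.
move=> [lDelta loc].
have locE u : exists a (phi : V -> K^o), [/\ linear phi,
    forall x y, phi (lie x y) = 0 & Delta u = a *: u + phi u *: v Bz].
  have [D /half_derivationP[a [phi [lphi phi0 DE]]] ->] := loc u.
  by exists a, phi; rewrite DE.
have DeltaD u w : Delta (u + w) = Delta u + Delta w.
  by have := lDelta 1 u w; rewrite !scale1r.
have eE : v Be = lie (2%:R^-1 *: v Bh) (v Be).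
  by rewrite lieZl lie_bvec scalerA mulVf ?scale1r ?pnatr_eq0.
have zE : v Bz = lie (v (Bx (Ordinal hn))) (v (By (Ordinal hn))).
  by rewrite lie_bvec /basis_lie eqxx scale1r.
have phie (phi : V -> K^o) : (forall x y, phi (lie x y) = 0) -> phi (v Be) = 0.
  by move=> phi0; rewrite eE.
have phiz (phi : V -> K^o) : (forall x y, phi (lie x y) = 0) -> phi (v Bz) = 0.
  by move=> phi0; rewrite zE.
have [a De] : exists a, Delta (v Be) = a *: v Be.
  have [a [phi [_ phi0 ->]]] := locE (v Be).
  by exists a; rewrite phie // scale0r addr0.
(* Here phi' must vanish at e + z: the z-coordinate alone does not separate the
   eigenvalue of z from the value of phi'. *)
have Dz : Delta (v Bz) = a *: v Bz.
  have [az [phi [_ phi0 DzE]]] := locE (v Bz).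
  rewrite phiz // scale0r addr0 in DzE.
  have [a' [phi' [lphi' phi0' E]]] := locE (v Be + v Bz).
  have phiez : phi' (v Be + v Bz) = 0.
    by have := lphi' 1 (v Be) (v Bz); rewrite !scale1r phie // phiz // addr0.
  rewrite DeltaD De DzE phiez scale0r addr0 in E.
  have /ffunP/(_ Be) := E; have /ffunP/(_ Bz) := E.
  rewrite !ffunE /GRing.scale /= !sch_eqE !mulr0 !mulr1 !add0r !addr0 !mulr1.
  by rewrite DzE => -> ->.
have Db b : exists t : K, Delta (v b) = a *: v b + t *: v Bz.
  case: (eqVneq b Be) => [->|be]; first by exists 0; rewrite De scale0r addr0.
  case: (eqVneq b Bz) => [->|bz]; first by exists 0; rewrite Dz scale0r addr0.
  have [a1 [phi [_ _ DbE]]] := locE (v b).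
  have [a2 [phi' [_ _ E]]] := locE (v Be + v b).
  rewrite DeltaD De DbE in E; exists (phi (v b)); rewrite DbE.
  congr (_ *: _ + _).
  (* The coordinates at b and at e give a1 = a2 and a = a2. *)
  have /ffunP/(_ Be) := E; have /ffunP/(_ b) := E.
  rewrite !ffunE /GRing.scale /= !eqxx (negPf be) (negPf bz).
  rewrite !(eq_sym Be) (negPf be) sch_eqE !mulr0 !addr0 !add0r !mulr1 ?addr0.
  by move=> -> ->.
pose psi u : K^o := (Delta u - a *: u) Bz.
have lpsi : linear psi.
  move=> t u w; rewrite /psi lDelta !ffunE /GRing.scale /=; ring.
have DE u : Delta u = a *: u + psi u *: v Bz.
  move: u; apply: linear_bvec_eq => // [t u w|b].
    by rewrite lpsi scalerDl !scalerDr !scalerA addrACA (mulrC a).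
  have [t Dt] := Db b; rewrite Dt; congr (_ + _ *: _).
  by rewrite /psi Dt addrC addKr !ffunE eqxx /GRing.scale /= mulr1.
apply/half_derivationP; exists a, psi; split=> // x y.
have [a' [phi [_ phi0 E]]] := locE (lie x y).
rewrite phi0 scale0r addr0 in E.
case: (eqVneq a' a) => [aa|aa]; first by rewrite /psi E aa subrr ffunE.
(* If a' and a differ, the bracket is itself a multiple of z, where psi is 0. *)
have psiz : psi (v Bz) = 0 by rewrite /psi Dz subrr ffunE.
have -> : lie x y = (psi (lie x y) / (a' - a)) *: v Bz.
  apply: (@scalerI _ _ (a' - a)); first by rewrite subr_eq0.
  rewrite scalerA mulrC divfK ?subr_eq0 // scalerBl -E DE.
  by rewrite addrC addKr.
by rewrite (GRing.scalable_linear lpsi) psiz; exact: mulr0.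
Qed.

End Schrodinger.

Theorem theorem24 (R : realType) (n : nat) (hn : (1 <= n)%N) :
  (forall Delta : schrodinger R[i] n -> schrodinger R[i] n,
     local_half_derivation Delta -> half_derivation Delta) /\
  (forall nabla : schrodinger R[i] n -> schrodinger R[i] n,
     two_local_half_derivation nabla -> half_derivation nabla).
Proof.
split=> [Delta|nabla].
  exact: local_half_derivation_schrodinger.
exact: two_local_half_derivation_schrodinger.
Qed.
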